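(* Let $s$ and $k$ be positive integers such that $3 \mid k+s$ and $\gcd(s,3k)=\gcd(3,k)=1$. Let $u$ be a primitive element of $GF(2^{3k})$ and let $v,w\in GF(2^k)$ with $v\neq w^{-1}$ (i.e. $vw\neq 1$). Then the function $F: GF(2^{3k})\to GF(2^{3k})$ given by $$F(x)=u^{2^k}x^{2^{-k}+2^{k+s}}+u\,x^{2^{s}+1}+v\,x^{2^{-k}+1}+w\,u^{2^k+1}x^{2^{k+s}+2^s}$$ is almost perfect nonlinear (APN) on $GF(2^{3k})$.
   Context: $GF(2^m)$ denotes the finite field with $2^m$ elements, and $GF(2^k)$ is regarded as the subfield of $GF(2^{3k})$ of order $2^k$. A primitive element of $GF(2^{3k})$ is a generator of its multiplicative group. For $x\in GF(2^{3k})$, $x^{2^{-k}}$ denotes the image of $x$ under the inverse of the automorphism $x\mapsto x^{2^k}$, so $x^{2^{-k}}=x^{2^{2k}}$; accordingly $x^{2^{-k}+2^{k+s}}=x^{2^{2k}}\cdot x^{2^{k+s}}$ and $x^{2^{-k}+1}=x^{2^{2k}}\cdot x$. The condition $v\neq w^{-1}$ means $vw\neq 1$; in particular it holds automatically when $w=0$. For a finite field $L=GF(2^n)$, a function $f:L\to L$ is called almost perfect nonlinear (APN) on $L$ if for all $p,q\in L$ with $q\neq 0$, the equation $f(x+q)+f(x)=p$ has at most $2$ solutions $x\in L$. *)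

(* Defs.v *)
From mathcomp Require Import all_boot all_order all_algebra.
From mathcomp Require Import all_fingroup all_solvable all_field.

Set Implicit Arguments.
Unset Strict Implicit.
Unset Printing Implicit Defensive.

Import GRing.Theory.
Local Open Scope ring_scope.

Definition apn (L : finFieldType) (f : L -> L) : Prop :=
  forall p q : L, q != 0 -> (#|[set x : L | (f (x + q) + f x == p)%R]| <= 2)%N.

Definition primitive_element (L : finFieldType) (u : L) : Prop :=
  exists2 g : {unit L}, generator [set: {unit L}] g & u = FinRing.uval g.

Definition subfield_of_order (L : finFieldType) (q : nat) (K : {set L}) : Prop :=
  GRing.divring_closed (mem K) /\ #|K| = q.

(* In GF(2^(3k)), x^(2^(-k)) is the preimage of x under x |-> x^(2^k), that is
   x^(2^(2k)); the two cancellation facts below justify this encoding. *)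
Definition inv_frob (L : finFieldType) (k : nat) (x : L) : L :=
  x ^+ (2 ^ (2 * k)).

Lemma inv_frobK (L : finFieldType) (k : nat) (hL : #|L| = (2 ^ (3 * k))%N) :
  cancel (@inv_frob L k) (fun x : L => x ^+ (2 ^ k)).
Proof.
by move=> x; rewrite /inv_frob -exprM -expnD -mulSnr -hL expf_card.
Qed.

Lemma frobK_inv (L : finFieldType) (k : nat) (hL : #|L| = (2 ^ (3 * k))%N) :
  cancel (fun x : L => x ^+ (2 ^ k)) (@inv_frob L k).
Proof.
by move=> x; rewrite /inv_frob -exprM -expnD -mulSn -hL expf_card.
Qed.

(* Main.v *)
Require Import Defs.
From mathcomp Require Import all_boot all_order all_algebra.
From mathcomp Require Import all_fingroup all_solvable all_field.
From HB Require Import structures.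
From mathcomp Require Import ring zify.
Import GRing.Theory.
Set Implicit Arguments.
Unset Strict Implicit.
Unset Printing Implicit Defensive.
Local Open Scope ring_scope.

(** Write [q = 2 ^ k], let [sigma] be the [q]-power map, of order 3 on [L], and
let [tau] be the [2 ^ s]-power map.  Since [F] is a quadratic form in
characteristic 2, [F] is APN as soon as, for each [c != 0], the second
difference of [F] at [x0] in the directions [c] and [c z] vanishes only for
[z = 0] and [z = 1].  That second difference is [c * c ^ (q^2)] times
[[
  sigma a (sigma (tau z) - sigma^2 z) - a (tau z - z)
    + v (sigma^2 z - z) + w a (sigma a) (tau z - sigma (tau z))
]]
where [a = u * c ^ (2 ^ s - q ^ 2)] ([quad_form_second_difference]).  The signs
are immaterial in characteristic 2; with this choice the eliminations below are
identities over the integers.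

Suppose that this expression vanishes.  Applying [sigma] twice gives three linear
equations.  Put [x_i = sigma^i z], [a_i = sigma^i a] and [X_i = tau x_i].  The
sum of the three, and their sum with weights [a_2], [a_0], [a_1], read
[T + w U = 0] and [U + v T = 0], where
[[
  T = a_0 (x_0 - x_1) + a_1 (x_1 - x_2) + a_2 (x_2 - x_0)
  U = a_0 a_1 (X_0 - X_1) + a_1 a_2 (X_1 - X_2) + a_2 a_0 (X_2 - X_0)
]]
As [v w != 1], both [T] and [U] are zero ([diff_form_elimination]).

The contradiction comes from the power residue symbol [res7 x = x ^ ((q^3-1)/7)].
Because 3 does not divide [k], 7 divides [q^2 + q + 1], so [res7] is trivial on
the nonzero elements of the subfield [GF(q)].  Because 3 divides [k + s], both
[sigma tau] and [tau sigma^-2] preserve [res7]; hence [res7 a = res7 u], which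
is not 1 since [u] is primitive.  Now if [z] is not in [GF(q)], then [T = U = 0]
forces [a = d * sigma (tau b) / b] with [b = sigma a - sigma^2 a] and [d] in
[GF(q)], so [res7 a = 1], which is absurd.  Hence [z] is in [GF(q)]; the equation
then reduces to [(sigma a - a) (tau z - z) = 0], so [tau z = z], and
[gcd(s, 3k) = 1] leaves only [z] in [GF(2)] ([diff_form_kernel]). *)

(** * Frobenius powers *)

(** The proof of membership in [pchar R] is an argument only so that the ring
morphism structure below can be attached to this function. *)
Definition frob (p : nat) (R : comNzRingType) (pcharRp : p \in [pchar R])
  (n : nat) (x : R) : R := x ^+ (p ^ n).

Section FrobeniusMorphism.
Variables (p : nat) (R : comNzRingType) (pcharRp : p \in [pchar R]) (n : nat).

Fact frob_is_zmod_morphism : zmod_morphism (frob pcharRp n).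
Proof.
have pnat_pn : [pchar R].-nat (p ^ n)%N.
  by rewrite pnatX pnatE ?pcharRp ?(pcharf_prime pcharRp).
by move=> x y; rewrite /frob exprDn_pchar // exprNn_pchar.
Qed.

Fact frob_is_monoid_morphism : monoid_morphism (frob pcharRp n).
Proof. by split=> [|x y]; rewrite /frob ?expr1n ?exprMn. Qed.

HB.instance Definition _ :=
  GRing.isZmodMorphism.Build R R (frob pcharRp n) frob_is_zmod_morphism.
HB.instance Definition _ :=
  GRing.isMonoidMorphism.Build R R (frob pcharRp n) frob_is_monoid_morphism.
End FrobeniusMorphism.

Lemma frobD (p : nat) (R : comNzRingType) (ch : p \in [pchar R]) (m n : nat)
  (x : R) : frob ch (m + n) x = frob ch m (frob ch n x).
Proof. by rewrite /frob -exprM -expnD addnC. Qed.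

Lemma frob_mul_fixed (p : nat) (R : comNzRingType) (ch : p \in [pchar R])
  (n j : nat) (x : R) : frob ch n x = x -> frob ch (j * n) x = x.
Proof.
move=> fx; elim: j => [|j IHj]; first by rewrite mul0n /frob expr1.
by rewrite mulSn frobD IHj.
Qed.

(** Fixed points of two Frobenius powers are fixed by the power whose exponent is
their gcd: Bezout writes [i * m = j * n + 1]. *)
Lemma frob_coprime_fixed (p : nat) (R : comNzRingType) (ch : p \in [pchar R])
  (m n : nat) (x : R) : (0 < m)%N -> coprime m n ->
  frob ch m x = x -> frob ch n x = x -> x ^+ p = x.
Proof.
move=> m_gt0 /eqP co_mn fm fn; case: (egcdnP n m_gt0) => i j.
rewrite co_mn => def_im _; have := frob_mul_fixed i fm.
by rewrite def_im addnC frobD (frob_mul_fixed j fn) /frob expn1.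
Qed.

(** Fermat's argument: multiplication by a nonzero [x] permutes the nonzero
elements of [K], so it leaves their product unchanged. *)
Lemma subfield_expf_card (L : finFieldType) (q : nat) (K : {set L}) (x : L) :
  subfield_of_order q K -> x \in K -> x ^+ q = x.
Proof.
move=> [[K1 KB KV] cardK] Kx.
have K0 : 0 \in K by rewrite -(subrr 1) KB.
have q_gt0 : (0 < q)%N by rewrite -cardK; apply/card_gt0P; exists 0.
have KM y z : y \in K -> z \in K -> y * z \in K.
  by move=> Ky Kz; rewrite -[z]invrK -[z^-1]mul1r KV // KV.
have [->|nz_x] := eqVneq x 0; first by rewrite expr0n -(prednK q_gt0).
pose P := \prod_(y in K :\ 0) y.
have nzP : P != 0 by apply/prodf_neq0 => y; rewrite !inE => /andP[].
have defP : P = x ^+ #|K :\ 0| * P.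
  rewrite {1}/P (reindex_inj (mulfI nz_x)) /= -prodr_const -big_split /=.
  apply: eq_bigl => y; rewrite !inE mulf_eq0 (negPf nz_x) /=; congr (_ && _).
  apply/idP/idP => [Kxy|]; last exact: KM.
  by rewrite -(mulKf nz_x y) mulrC KV.
have xq1 : x ^+ #|K :\ 0| = 1 by apply: (mulIf nzP); rewrite mul1r -defP.
have -> : q = #|K :\ 0|.+1 by rewrite -cardK (cardsD1 0 K) K0.
by rewrite exprS xq1 mulr1.
Qed.

(** * The seventh power residue symbol *)

Lemma expn2_mod7 (m n : nat) :
  m = n %[mod 3] -> (2 ^ m = 2 ^ n %[mod 7])%N.
Proof.
have red j : (2 ^ j = 2 ^ (j %% 3) %[mod 7])%N.
  rewrite {1}(divn_eq j 3) mulnC expnD expnM -modnMml -modnXm.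
  by rewrite (_ : (2 ^ 3) %% 7 = 1)%N // exp1n mul1n.
by move=> e; rewrite (red m) (red n) e.
Qed.

(** [2 ^ k] is a primitive cube root of unity modulo 7. *)
Lemma dvdn7_expn2 (k : nat) : coprime 3 k -> (7 %| 2 ^ (2 * k) + 2 ^ k + 1)%N.
Proof.
move=> co3k; have := esym (expn2_mod7 (modn_mod k 3)) => e.
rewrite mulnC expnM /dvdn -modnDml -(modnDm (_ ^ 2)) -modnXm e modnXm modnDm.
rewrite modnDml; have : (k %% 3 != 0)%N by rewrite -/(3 %| k)%N -prime_coprime.
by have := ltn_pmod k (isT : 0 < 3)%N; case: (k %% 3)%N => [|[|[|]]].
Qed.

Lemma subn1_cube (q : nat) :
  (q ^ 3 - 1 = (q - 1) * (q ^ 2 + q + 1))%N.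
Proof. by case: q => [|q] //; rewrite !subn1 /=; nia. Qed.

Definition res7 (L : finFieldType) (x : L) : L := x ^+ ((#|L| - 1) %/ 7).

Lemma res7M (L : finFieldType) (x y : L) : res7 (x * y) = res7 x * res7 y.
Proof. exact: exprMn. Qed.

Section SeventhResidue.
Variables (k : nat) (L : finFieldType).
Hypotheses (co3k : coprime 3 k) (hL : #|L| = (2 ^ (3 * k))%N).

Lemma card_units_factor :
  (#|L| - 1 = (2 ^ k - 1) * (2 ^ (2 * k) + 2 ^ k + 1))%N.
Proof. by rewrite hL ![(_ * k)%N]mulnC !expnM subn1_cube. Qed.

Lemma dvdn7_card : (7 %| #|L| - 1)%N.
Proof. by rewrite card_units_factor dvdn_mull ?dvdn7_expn2. Qed.

Lemma res7_exp7 (x : L) : x != 0 -> res7 x ^+ 7 = 1.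
Proof.
move=> nz_x; rewrite -exprM divnK ?dvdn7_card //; apply: (mulIf nz_x).
by rewrite mul1r -exprSr subn1 prednK ?expf_card // hL expn_gt0.
Qed.

(** [res7] takes values in the seventh roots of unity, on which the Frobenius
acts with order dividing 3. *)
Lemma res7_frob (m n : nat) (x : L) : x != 0 -> m = n %[mod 3] ->
  res7 (x ^+ (2 ^ m)) = res7 (x ^+ (2 ^ n)).
Proof.
move=> nz_x /expn2_mod7 emn.
have res7X j : res7 (x ^+ j) = res7 x ^+ j by rewrite /res7 exprAC.
have x7 := res7_exp7 nz_x.
by rewrite !res7X -(expr_mod (2 ^ m) x7) emn (expr_mod _ x7).
Qed.

(** A nonzero [x] of [GF(2 ^ k)] satisfies [x ^ (q - 1) = 1] with [q = 2 ^ k],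
and [(q ^ 3 - 1) / 7] is a multiple of [q - 1]. *)
Lemma res7_subfield (x : L) : x != 0 -> x ^+ (2 ^ k) = x -> res7 x = 1.
Proof.
move=> nz_x xq; have x1 : x ^+ (2 ^ k - 1) = 1.
  apply: (mulIf nz_x); rewrite mul1r -exprSr subn1 prednK ?xq //.
  by rewrite expn_gt0.
by rewrite /res7 card_units_factor -muln_divA ?dvdn7_expn2 // exprM x1 expr1n.
Qed.

Lemma res7_primitive (u : L) : primitive_element u -> res7 u != 1.
Proof.
move=> [g /eqP gen_g def_u]; apply/eqP => u1.
have g1 : (g ^+ ((#|L| - 1) %/ 7) == 1)%g.
  by apply/eqP/val_inj; rewrite FinRing.val_unitX /= -def_u.
have card_gt1 : (0 < #|L| - 1)%N by rewrite subn_gt0 card_finNzRing_gt1.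
rewrite -order_dvdn orderE -gen_g card_finField_unit -subn1 in g1.
have := dvdn_leq _ g1; rewrite divn_gt0 // (dvdn_leq _ dvdn7_card) //.
by move=> /(_ isT); rewrite leqNgt ltn_Pdiv.
Qed.
End SeventhResidue.

(** * The linearised difference equation *)

(** The primes stand for conjugation by [sigma]: [x''] is [sigma^2 x], [X] is
[tau x] and [X'] is [sigma (tau x)]; keeping them as independent variables
turns the elimination into polynomial algebra. *)
Definition diff_form (R : pzRingType) (v w a a' x x'' X X' : R) : R :=
  a' * (X' - x'') - a * (X - x) + v * (x'' - x) + w * a * a' * (X - X').

(** The function of the theorem, in the same independent variables. *)
Definition quad_form (R : pzRingType) (u u' v w x x'' X X' : R) : R :=
  u' * (x'' * X') + u * (X * x) + v * (x'' * x) + w * u * u' * (X' * X).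

(** The two relations, solved for [a] and [a'], give [a = u C / c''] and its
[sigma]-conjugate; with them each monomial of the polarisation of [quad_form] at
[c] becomes [c * c''] times a monomial of [diff_form]. *)
Lemma quad_form_second_difference (R : comNzRingType) (ch2 : 2 \in [pchar R])
  (u u' v w a a' c c'' C C' y y'' Y Y' z z'' Z Z' : R) :
  a * c'' = u * C -> a' * c = u' * C' ->
  quad_form u u' v w (y + c * z + c) (y'' + c'' * z'' + c'')
      (Y + C * Z + C) (Y' + C' * Z' + C')
    - quad_form u u' v w (y + c * z) (y'' + c'' * z'') (Y + C * Z) (Y' + C' * Z')
    - quad_form u u' v w (y + c) (y'' + c'') (Y + C) (Y' + C')
    + quad_form u u' v w y y'' Y Y'
  = c * c'' * diff_form v w a a' z z'' Z Z'.
Proof.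
move=> Ea Ea'.
transitivity (c'' * (a' * c) * (Z' + z'') + c * (a * c'') * (Z + z)
    + v * c * c'' * (z'' + z) + w * (a * c'') * (a' * c) * (Z + Z')).
  (* The signs on the left make this hold in every characteristic; only the
     passage to [diff_form] changes signs. *)
  by rewrite Ea Ea' /quad_form; ring.
by rewrite /diff_form !(oppr_pchar2 ch2); ring.
Qed.

(** The three hypotheses are one equation and its two conjugates.  Their sum
involves the [X_i] through [U] only; the sum weighted by [a2], [a0], [a1] cancels
the terms [a_i a_j x_l], so that the [x_i] remain in [v T] only. *)
Lemma diff_form_elimination (F : fieldType)
  (v w a0 a1 a2 x0 x1 x2 X0 X1 X2 : F) :
  v * w != 1 ->
  diff_form v w a0 a1 x0 x2 X0 X1 = 0 ->
  diff_form v w a1 a2 x1 x0 X1 X2 = 0 ->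
  diff_form v w a2 a0 x2 x1 X2 X0 = 0 ->
  a0 * (x0 - x1) + a1 * (x1 - x2) + a2 * (x2 - x0) = 0 /\
  a0 * a1 * (X0 - X1) + a1 * a2 * (X1 - X2) + a2 * a0 * (X2 - X0) = 0.
Proof.
set D0 := diff_form v w a0 _ _ _ _ _; set D1 := diff_form v w a1 _ _ _ _ _.
set D2 := diff_form v w a2 _ _ _ _ _; move=> nvw1 G0 G1 G2.
set T := (X in X = 0 /\ _); set U := (X in _ /\ X = 0).
have TwU : T + w * U = 0.
  have -> : T + w * U = D0 + D1 + D2.
    by rewrite /T /U /D0 /D1 /D2 /diff_form; ring.
  by rewrite G0 G1 G2 !addr0.
have UvT : U + v * T = 0.
  have -> : U + v * T = a2 * D0 + a0 * D1 + a1 * D2.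
    by rewrite /T /U /D0 /D1 /D2 /diff_form; ring.
  by rewrite G0 G1 G2 !mulr0 !addr0.
have T0 : T = 0.
  have nz : 1 - v * w != 0 by rewrite subr_eq0 eq_sym.
  apply: (mulfI nz); rewrite mulr0.
  have -> : (1 - v * w) * T = T + w * U - w * (U + v * T) by ring.
  by rewrite TwU UvT !mulr0 subr0.
by split=> //; move: UvT; rewrite T0 mulr0 addr0.
Qed.

(** The differences [x0 - x1], [x1 - x2], [x2 - x0] sum to zero, so one linear
relation between them already fixes the ratio of the first two; the same holds
for the [X_i]. *)
Lemma diff_form_ratio (F : fieldType) (a0 a1 a2 x0 x1 x2 X0 X1 X2 : F) :
  a0 * (x0 - x1) + a1 * (x1 - x2) + a2 * (x2 - x0) = 0 ->
  a0 * a1 * (X0 - X1) + a1 * a2 * (X1 - X2) + a2 * a0 * (X2 - X0) = 0 ->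
  (x1 - x2) * (a1 - a2) = (x0 - x1) * (a2 - a0) /\
  a0 * (X0 - X1) * (a1 - a2) = a2 * (X1 - X2) * (a0 - a1).
Proof.
move=> T0 U0; split; apply/eqP; rewrite -subr_eq0; apply/eqP.
  by rewrite -[RHS]T0; ring.
by rewrite -[RHS]U0; ring.
Qed.

Section Kernel.
Variables (k s : nat) (L : finFieldType).
Hypotheses (co3k : coprime 3 k) (cosk : coprime s (3 * k)) (h3 : (3 %| k + s)%N).
Hypothesis hL : #|L| = (2 ^ (3 * k))%N.

(** Outside [GF(2 ^ k)] the two ratios of [diff_form_ratio], compared through
[tau], show that [a * b / tau (sg b)] is fixed by [sg]; this makes [res7 a]
trivial. *)
Lemma diff_form_kernel (v w a z : L) :
  v ^+ (2 ^ k) = v -> w ^+ (2 ^ k) = w -> v * w != 1 -> a != 0 ->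
  res7 a != 1 ->
  diff_form v w a (a ^+ (2 ^ k)) z (z ^+ (2 ^ (2 * k)))
    (z ^+ (2 ^ s)) (z ^+ (2 ^ (k + s))) = 0 ->
  z = 0 \/ z = 1.
Proof.
move=> vq wq nvw1 nz_a res_a.
have ch2 : 2 \in [pchar L] by apply: (card_finPcharP hL).
pose sg : {rmorphism L -> L} := frob ch2 k.
pose tau : {rmorphism L -> L} := frob ch2 s.
have sgE x : x ^+ (2 ^ k) = sg x by [].
have sg2E x : x ^+ (2 ^ (2 * k)) = sg (sg x) by rewrite mul2n -addnn; apply: frobD.
have sg3 x : sg (sg (sg x)) = x.
  rewrite /= -!frobD (_ : k + k + k = 3 * k)%N; last by lia.
  by rewrite /frob -hL expf_card.
have tauE x : x ^+ (2 ^ s) = tau x by [].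
have sgtauE x : x ^+ (2 ^ (k + s)) = sg (tau x) by apply: frobD.
have tausg x : tau (sg x) = sg (tau x) by rewrite /= -!frobD addnC.
rewrite !(sgE, sg2E, tauE, sgtauE) in vq wq * => G0.
(* [diff_form] has coefficients [v], [w] fixed by [sg], so [sg] only moves its
   variables. *)
have sgG b b' x x'' X X' : diff_form v w b b' x x'' X X' = 0 ->
  diff_form v w (sg b) (sg b') (sg x) (sg x'') (sg X) (sg X') = 0.
  move/(congr1 sg); rewrite /diff_form.
  by rewrite !(rmorphB, rmorphD, rmorphM, rmorph0) vq wq.
have := sgG _ _ _ _ _ _ G0; rewrite !sg3 => G1.
have := sgG _ _ _ _ _ _ G1; rewrite !sg3 => G2.
have [T0 U0] := diff_form_elimination nvw1 G0 G1 G2.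
have [Ex Ea] := diff_form_ratio T0 U0.
(* [a] lies outside the subfield, on which [res7] is trivial. *)
have nfix_a : sg a != a by apply: contraNneq res_a => /(res7_subfield co3k hL nz_a) ->.
have [fix_z|nfix_z] := eqVneq (sg z) z.
  have fix_tau : tau z = z.
    move: G0; rewrite /diff_form -tausg !fix_z !subrr !mulr0 !addr0 -mulrBl => /eqP.
    by rewrite mulf_eq0 !subr_eq0 (negPf nfix_a) => /eqP.
  have s_gt0 : (0 < s)%N.
    by case: (s) cosk (co3k) => // /eqP; rewrite gcd0n => /eqP; rewrite muln_eq1.
  have z_in_F2 : z ^+ 2 = z.
    apply: (frob_coprime_fixed (ch := ch2) s_gt0 cosk fix_tau).
    exact: frob_mul_fixed fix_z.
  have /eqP : z * (z - 1) = 0 by rewrite mulrBr mulr1 -expr2 z_in_F2 subrr.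
  by rewrite mulf_eq0 subr_eq0 => /orP[] /eqP; [left | right].
(* From here on [z] is outside the subfield, and [res7 a = 1] is derived. *)
exfalso; move/negP: res_a; apply.
pose b := sg a - sg (sg a).
have sgb : sg b = sg (sg a) - a by rewrite /b rmorphB /= sg3.
have sg2b : sg (sg b) = a - sg a by rewrite sgb rmorphB /= sg3.
have nz_b : b != 0.
  by apply: contra_neq nfix_a => b0; apply/eqP; rewrite eq_sym -subr_eq0 -sg2b b0 !rmorph0.
have nz_y : z - sg z != 0 by rewrite subr_eq0 eq_sym.
have Eb : a * b * tau b = sg (sg a) * sg (sg b) * tau (sg b).
  have nz_ty : tau (z - sg z) != 0 by rewrite fmorph_eq0.
  apply: (mulfI nz_ty).
  have {}Ex := congr1 tau Ex.
  move: Ex Ea; rewrite -!tausg -!(rmorphB tau) /= !rmorphM /= -/b -sgb -sg2b => Ex Ea.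
  transitivity (a * tau (z - sg z) * b * tau b); first by ring.
  rewrite Ea.
  transitivity (sg (sg a) * sg (sg b) * (tau (sg z - sg (sg z)) * tau b)).
    by ring.
  by rewrite Ex; ring.
pose c := a * b / tau (sg b).
have nz_c : c != 0 by rewrite !mulf_neq0 ?invr_eq0 ?fmorph_eq0.
have sg2c : sg (sg c) = c.
  apply/eqP; rewrite /c !(rmorphM, fmorphV) /= -tausg !tausg sg3.
  by rewrite eqr_div ?fmorph_eq0 // Eb -!tausg.
(* [sg] is the inverse of its square, so it fixes [c] too. *)
have sgc : sg c = c by rewrite -{2}[c]sg3 sg2c.
have def_a : a = c * (tau (sg b) / b).
  by rewrite /c; field; rewrite nz_b !fmorph_eq0.
have res_b : res7 b != 0 by rewrite expf_neq0.
rewrite def_a res7M (res7_subfield co3k hL nz_c sgc) mul1r.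
apply/eqP/(mulIf res_b); rewrite mul1r -res7M divfK //.
(* [sg (tau b)] is the power of [b] of exponent [2 ^ (s + k)], and 3 divides
   [s + k]. *)
rewrite -sgE -tauE -exprM -expnD -[in RHS](expr1 b) -(expn0 2).
by apply: (res7_frob co3k hL nz_b); apply/eqP; rewrite mod0n.
Qed.
End Kernel.

(** * Almost perfect nonlinearity *)

Theorem theorem1 (s k : nat) (hs : (0 < s)%N) (hk : (0 < k)%N)
  (h3 : (3 %| k + s)%N) (hgcd1 : gcdn s (3 * k) = 1%N) (hgcd2 : gcdn 3 k = 1%N)
  (L : finFieldType) (hL : #|L| = (2 ^ (3 * k))%N)
  (K : {set L}) (hK : subfield_of_order (2 ^ k) K)
  (u : L) (hu : primitive_element u)
  (v w : L) (hv : v \in K) (hw : w \in K) (hvw : v * w != 1) :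
  apn (fun x : L =>
         u ^+ (2 ^ k) * (inv_frob k x * x ^+ (2 ^ (k + s)))
         + u * x ^+ (2 ^ s + 1)
         + v * (inv_frob k x * x)
         + w * u ^+ (2 ^ k + 1) * x ^+ (2 ^ (k + s) + 2 ^ s)).
Proof.
have co3k : coprime 3 k by apply/eqP.
have cosk : coprime s (3 * k) by apply/eqP.
have ch2 : 2 \in [pchar L] by apply: (card_finPcharP hL).
have vq := subfield_expf_card hK hv; have wq := subfield_expf_card hK hw.
have nz_u : u != 0 by case: hu => g _ ->; rewrite -unitfE; apply: (valP g).
move=> p c nz_c.
set S := [set x | _].
(* Two solutions [x0] and [x] give a vanishing second difference, in the
   directions [c] and [x - x0]; so all solutions are [x0] and [x0 + c]. *)
have [->|[x0]] := set_0Vmem S; first by rewrite cards0.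
rewrite inE => /eqP Sx0.
suff sub : S \subset [set x0; x0 + c].
  by apply: leq_trans (subset_leq_card sub) _; rewrite cards2; case: (_ != _).
apply/subsetP=> x; rewrite !inE => /eqP Sx.
have [z def_x] : exists z, x = x0 + c * z.
  by exists ((x - x0) / c); rewrite mulrCA divff // mulr1 addrC subrK.
pose a := u * c ^+ (2 ^ s) / c ^+ (2 ^ (2 * k)).
have nz_a : a != 0 by rewrite !mulf_neq0 ?invr_eq0 ?expf_neq0.
have res_a : res7 a != 1.
  (* [s] and [2 * k] are congruent modulo 3, so the powers of [c] in [a] cancel
     under [res7]. *)
  have res_c : res7 (c ^+ (2 ^ (2 * k))) != 0 by rewrite !expf_neq0.
  apply: contra_neq (res7_primitive co3k hL hu) => a1.
  apply: (mulIf res_c); rewrite mul1r.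
  rewrite -{1}(res7_frob co3k hL (m := s) nz_c); last by move/eqP: h3 => h3'; lia.
  by rewrite -res7M -(mul1r (res7 (c ^+ _))) -a1 -res7M divfK ?expf_neq0.
suff [z0|z1] : z = 0 \/ z = 1.
- by rewrite def_x z0 mulr0 addr0 eqxx.
- by rewrite def_x z1 mulr1 eqxx orbT.
apply: (diff_form_kernel co3k cosk h3 hL vq wq hvw nz_a res_a).
pose f2k := frob ch2 (2 * k); pose fs := frob ch2 s; pose fks := frob ch2 (k + s).
pose Q x' := quad_form u (u ^+ (2 ^ k)) v w x' (f2k x') (fs x') (fks x').
have QE x' : u ^+ (2 ^ k) * (inv_frob k x' * x' ^+ (2 ^ (k + s)))
         + u * x' ^+ (2 ^ s + 1) + v * (inv_frob k x' * x')
         + w * u ^+ (2 ^ k + 1) * x' ^+ (2 ^ (k + s) + 2 ^ s) = Q x'.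
  by rewrite /Q /quad_form /f2k /fs /fks /frob /inv_frob !exprD expr1; ring.
rewrite !QE in Sx Sx0.
have Ea : a * f2k c = u * fs c by rewrite divfK ?expf_neq0.
have Ea' : a ^+ (2 ^ k) * c = u ^+ (2 ^ k) * fks c.
  have cE : c = frob ch2 k (f2k c).
    by rewrite -frobD -mulSn /frob -hL expf_card.
  by rewrite [X in _ * X]cE -exprMn Ea exprMn /fks frobD.
have nz_cc : c * f2k c != 0 by rewrite mulf_neq0 ?expf_neq0.
apply: (mulfI nz_cc); rewrite mulr0.
rewrite -(quad_form_second_difference ch2 v w x0 (f2k x0) (fs x0) (fks x0) _ _ _ _ Ea Ea').
transitivity (Q (x0 + c * z + c) - Q (x0 + c * z) - Q (x0 + c) + Q x0).
  by rewrite /Q /f2k /fs /fks !(rmorphD, rmorphM).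
by rewrite -def_x !(oppr_pchar2 ch2) Sx -addrA Sx0 addrr_pchar2.
Qed.
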